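(* Let $N$ be a normal subgroup of a finite group $G$. If there is a unique real $G$-conjugacy class in $N$, then $N$ is of odd order. The converse is not true in general: there exist a finite group $G$ and a normal subgroup $N$ of $G$ of odd order such that $N$ contains more than one real $G$-conjugacy class.
   Context: A $G$-conjugacy class of $N$ is a conjugacy class $x^G$ of $G$ with $x\in N$; it is real if $x^G=(x^{-1})^G$. The class $\{1\}$ is always real. *)

(* Defs.v *)
From mathcomp Require Import all_boot all_fingroup.

Set Implicit Arguments.
Unset Strict Implicit.
Unset Printing Implicit Defensive.

Import GroupScope.

Definition real_Gclasses (gT : finGroupType) (G N : {set gT}) : {set {set gT}} :=
  [set x ^: G | x in N & x ^: G == x^-1 ^: G].

(* Main.v *)
(** An element of order 2 is its own inverse, so by Cauchy a normal subgroup of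
    even order has a real class besides [1].  For the failure of the converse,
    take [G = S_3] and [N = A_3]: if [s], [t] are distinct transpositions, then
    [s] conjugates the 3-cycle [s * t] to its inverse [t * s]. *)
Require Import Defs.
From mathcomp Require Import all_boot all_fingroup.
From mathcomp Require Import pgroup alt.

Set Implicit Arguments.
Unset Strict Implicit.
Unset Printing Implicit Defensive.

Import GroupScope.

(** The class of 1 is real and equals {1}, so it differs from the class of [x]. *)
Lemma real_Gclasses_gt1 (gT : finGroupType) (G N : {group gT}) x :
  x \in N -> x != 1 -> x ^: G = x^-1 ^: G -> (1 < #|real_Gclasses G N|)%N.
Proof.
move=> Nx ntx real_x; apply/card_gt1P; exists (x ^: G), (1 ^: G); split.
- by apply/imsetP; exists x; rewrite // inE Nx real_x eqxx.
- by apply/imsetP; exists 1; rewrite // inE group1 invg1 eqxx.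
by rewrite class1G classG_eq1.
Qed.

Lemma odd_card_real_Gclasses1 (gT : finGroupType) (G N : {group gT}) :
  #|real_Gclasses G N| = 1%N -> odd #|N|.
Proof.
move=> real1; apply: contraT; rewrite -dvdn2 => /(Cauchy (isT : prime 2))[x Nx ox].
suff: (1 < #|real_Gclasses G N|)%N by rewrite real1.
apply: (real_Gclasses_gt1 Nx); first by rewrite -order_eq1 ox.
by rewrite invg_expg ox expg1.
Qed.

Lemma real_Gclasses_Alt3_gt1 :
  (1 < #|real_Gclasses 'Sym_('I_3) 'Alt_('I_3)|)%N.
Proof.
pose s : 'S_3 := tperm ord0 (inord 1); pose t : 'S_3 := tperm ord0 ord_max.
have neq01 : ord0 != inord 1 :> 'I_3 by rewrite -val_eqE /= inordK.
have neq12 : inord 1 != ord_max :> 'I_3 by rewrite -val_eqE /= inordK.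
have sV : s^-1 = s by rewrite tpermV.
have tV : t^-1 = t by rewrite tpermV.
apply: (@real_Gclasses_gt1 _ _ _ (s * t)).
- by rewrite Alt_even odd_permM !odd_tperm neq01.
(* As [t] is an involution, [s * t = 1] would mean [s = t]; but they send [ord0] to different
   points. *)
- rewrite -tV -eq_mulgV1; apply: contraNneq neq12 => /permP/(_ ord0).
  by rewrite !tpermL => ->.
rewrite invMg sV tV -(_ : (s * t) ^ s = t * s) ?classGidl ?inE //.
by rewrite conjgE -mulgA mulKg.
Qed.

Theorem lemma5p6 :
  (forall (gT : finGroupType) (G N : {group gT}),
      N <| G -> #|real_Gclasses G N| = 1%N -> odd #|N|)
  /\
  (exists (gT : finGroupType) (G N : {group gT}),
      [/\ N <| G, odd #|N| & (1 < #|real_Gclasses G N|)%N]).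
Proof.
split=> [gT G N _|]; first exact: odd_card_real_Gclasses1.
exists {perm 'I_3}, 'Sym_('I_3)%G, 'Alt_('I_3)%G; split.
- exact: Alt_normal.
(* [card_Alt] gives twice the order of the alternating group as 3! = 6; cancelling 2 leaves 3, which
   is odd. *)
- have /eqP : (2 * #|'Alt_('I_3)|)%N = 6 by rewrite card_Alt card_ord.
  by rewrite -[6]/(2 * 3)%N eqn_pmul2l // => /eqP ->.
exact: real_Gclasses_Alt3_gt1.
Qed.
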